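(* Let $T>0$, let $\Omega$ be the torus $[0,1]$ (periodic boundary conditions), and let $a\in W^{1,\infty}(\Omega)$ (constant or not). Let $K=K(t,x)\ge 0$ and $K'=\kappa K$ for some constant $\kappa>0$. Let $u_{obs}$ solve $$\partial_t u_{obs}+a(x)\,\partial_x u_{obs}=0,\qquad u_{obs}|_{x=0}=u_{obs}|_{x=1},\qquad \partial_x u_{obs}|_{x=0}=\partial_x u_{obs}|_{x=1}$$ on $[0,T]\times\Omega$ with some initial condition $u_{obs}|_{t=0}=u_{obs}^0$. Consider the coupled forward-backward problem $$(F)\quad \partial_t u+a(x)\,\partial_x u=-K(u-u_{obs}),\qquad u|_{x=0}=u|_{x=1},\quad \partial_x u|_{x=0}=\partial_x u|_{x=1},\qquad u|_{t=0}=u_0,$$ $$(B)\quad \partial_t\tilde u+a(x)\,\partial_x\tilde u=K'(\tilde u-u_{obs}),\qquad \tilde u|_{x=0}=\tilde u|_{x=1},\quad \partial_x\tilde u|_{x=0}=\partial_x\tilde u|_{x=1},\qquad \tilde u|_{t=T}=u(T).$$ Set $w(t)=u(t)-u_{obs}(t)$ and $\tilde w(t)=\tilde u(t)-u_{obs}(t)$. Let $(s,\psi(s,x))$ be the characteristic curve, with foot $x$ at time $s=0$, of the equation $\partial_t u+a(x)\,\partial_x u=0$, that is, $\partial_s\psi(s,x)=a(\psi(s,x))$ and $\psi(0,x)=x$. Assume that $T$ is such that the characteristics are well defined and do not intersect over $[0,T]$. Then: 1. If $K(t,x)=K$ is constant (so $K'=\kappa K$ is constant), then for all $t\in[0,T]$,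 $$\tilde w(t)=w(t)\,e^{(-K-K')(T-t)}.$$ 2. If $K(t,x)=K\,\mathbf 1_{[t_1,t_2]}(t)$ with a constant $K>0$ and $0\le t_1<t_2\le T$ (so that $K'(t,x)=K'\,\mathbf 1_{[t_1,t_2]}(t)$ with the constant $K'=\kappa K$), then $$\tilde w(0)=w(0)\,e^{(-K-K')(t_2-t_1)}.$$ 3. If $K(t,x)=K(x)$ is independent of $t$ (so $K'(x)=\kappa K(x)$), then for all $t\in[0,T]$ and all $x\in\Omega$, $$\tilde w(t,\psi(t,x))=w(t,\psi(t,x))\,\exp\left(-\int_t^T \big(K(\psi(s,x))+K'(\psi(s,x))\big)\,ds\right).$$
   Context: The problem $(F)$-$(B)$ is one step of the ''back and forth nudging'' (BFN) algorithm for the inviscid linear transport equation: the forward equation $(F)$ is solved on $[0,T]$ from the initial condition $u_0$, and the backward equation $(B)$ is solved on $[0,T]$ from the final condition $\tilde u(T)=u(T)$. The pair $(u,\tilde u)$ denotes the solution of $(F)$-$(B)$. The function $K$ is the nudging gain and $\mathbf 1_I$ denotes the indicator function of the interval $I$. No specific function spaces for the data and the solutions are prescribed. *)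

(* Defs.v *)
(* Functions on the torus [0,1] are 1-periodic functions on R; the
   characteristics are lifted to R accordingly. *)
From HB Require Import structures.
From mathcomp Require Import all_boot all_order all_algebra.
From mathcomp Require Import all_classical all_reals all_analysis.

Set Implicit Arguments.
Unset Strict Implicit.
Unset Printing Implicit Defensive.

Import Order.TTheory GRing.Theory Num.Theory.
Import numFieldNormedType.Exports.

Local Open Scope classical_set_scope.
Local Open Scope ring_scope.

Definition ess_bounded (R : realType) (f : R -> R) : Prop :=
  measurable_fun [set: R] f /\
  exists M : R, {ae @lebesgue_measure R, forall x, `|f x| <= M}.

(* On the torus, integration by parts against a periodic test function has no
   boundary term. *)
Definition weak_derivative (R : realType) (f g : R -> R) : Prop :=
  forall phi : R -> R,
    periodic phi 1 ->
    (forall x, derivable phi x 1) -> continuous (derive1 phi) ->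
    \int[@lebesgue_measure R]_(x in `[0, 1]) (f x * derive1 phi x) =
    - \int[@lebesgue_measure R]_(x in `[0, 1]) (g x * phi x).

(* Elements of W^{1,oo} are classes modulo a.e. equality; f is taken to be the
   continuous representative, so that its pointwise values are meaningful. *)
Definition W1infty (R : realType) (f : R -> R) : Prop :=
  [/\ periodic f 1, continuous f, ess_bounded f &
      exists g : R -> R,
        [/\ periodic g 1, ess_bounded g & weak_derivative f g]].

Definition dt (R : realType) (u : R -> R -> R) (t x : R) : R :=
  derive1 (fun s => u s x) t.

Definition dx (R : realType) (u : R -> R -> R) (t x : R) : R :=
  derive1 (u t) x.

Definition C1_at (R : realType) (u : R -> R -> R) (t x : R) : Prop :=
  [/\ derivable (fun s => u s x) t 1,
      derivable (u t) x 1,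
      {for (t, x), continuous (fun p : R * R => dt u p.1 p.2)} &
      {for (t, x), continuous (fun p : R * R => dx u p.1 p.2)}].

(* Classical solution of u_t + a u_x = f on [0,T] x torus. The finite set E of
   exceptional times is needed when f jumps in time, as for a gain
   proportional to an indicator function of t: then u_t jumps in general and
   u is not C^1 across that time. *)
Record transport_solution (R : realType) (T : R) (a : R -> R)
    (f u : R -> R -> R) : Prop := TransportSolution {
  ts_periodic : forall t, 0 <= t <= T -> periodic (u t) 1;
  ts_continuous :
    {within [set p : R * R | 0 <= p.1 <= T],
      continuous (fun p : R * R => u p.1 p.2)};
  ts_bc : forall t, 0 <= t <= T -> u t 0 = u t 1;
  ts_equation : exists E : seq R, forall t, 0 < t < T -> t \notin E ->
    (forall x, C1_at u t x /\ dt u t x + a x * dx u t x = f t x) /\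
    dx u t 0 = dx u t 1 }.

Record characteristics (R : realType) (T : R) (a : R -> R)
    (psi : R -> R -> R) : Prop := Characteristics {
  char_foot : forall x, psi 0 x = x;
  char_continuous : forall x, {within `[0, T], continuous (fun s => psi s x)};
  char_ode : forall x s, 0 < s < T ->
    is_derive s 1 (fun r => psi r x) (a (psi s x)) }.

(* Equality of points of the torus is equality modulo 1 of their lifts. *)
Definition non_intersecting (R : realType) (T : R) (psi : R -> R -> R) : Prop :=
  forall s x y, 0 <= s <= T ->
    psi s x - psi s y \is a Num.int -> x - y \is a Num.int.

(* Main.v *)
Require Import Defs.
From HB Require Import structures.
From mathcomp Require Import all_boot all_order all_algebra.
From mathcomp Require Import all_classical all_reals all_analysis.
From mathcomp Require Import measurable_realfun.
From mathcomp Require Import ring lra.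

Set Implicit Arguments.
Unset Strict Implicit.
Unset Printing Implicit Defensive.

Import Order.TTheory GRing.Theory Num.Theory.
Import numFieldNormedType.Exports.

Local Open Scope classical_set_scope.
Local Open Scope ring_scope.

(** Write w = u - uobs and wt = ut - uobs, so that w is damped by the gain,
    w_t + a w_x = - K w, and wt is amplified by kappa K, with wt = w at time T.

    When the gain depends on time only, all points are treated at once. Choose a
    weight theta(t) with theta(T) = 1 and theta' = (1 + kappa) K theta, which is
    the exponential factor of the first two formulas. Then z = wt - w theta
    solves z_t + a z_x = kappa K z with z(T) = 0, and since the coefficient
    kappa K is nonnegative, a maximum principle run backwards in time forces
    z = 0 ([backward_max_principle], [nudging_time_dependent_gain]). At a maximum
    over the torus the x-derivative vanishes, so that the transport term
    disappears. The equality thus holds at every point, without asking whether a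
    characteristic starting at time 0 reaches it.

    When the gain depends on x, the solutions are followed along a
    characteristic ([transport_solution_along]). With k(s) = K(psi(s, x)) this
    turns the equations into W' = - k W and V' = kappa k V with V(T) = W(T),
    and [damped_amplified_ratio] compares the two. If W(T) is nonzero, then so is
    W before T, the function ln(W^2) has derivative - 2 k, and both W and V
    are explicit in terms of it. If W(T) = 0, then V(T) = 0 and V, whose square
    does not decrease, vanishes identically; the formula then says that W(t) is
    zero or that the integral of k is infinite, which holds because ln(W^2)
    tends to - oo before W vanishes. In this last case nothing makes k
    measurable after the first zero of W, but the integral of a nonnegative
    function is a supremum over simple functions, hence still monotone in the
    domain.

    The equations may fail at finitely many times. Every argument is first made
    on an interval free of such times, and [interval_split_ind] glues the
    pieces. *)

(** * Exceptional times and integration of a derivative *)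

(** A property of intervals that is additive under subdivision holds on a whole
    interval as soon as it holds on the pieces that avoid a finite set; this is
    how the finitely many exceptional times are absorbed. *)
Lemma interval_split_ind (R : realType) (E : seq R) (P : R -> R -> Prop)
    (lo hi : R) :
  (forall a m b, lo <= a -> a < m -> m < b -> b <= hi ->
     P a m -> P m b -> P a b) ->
  (forall a b, lo <= a -> a < b -> b <= hi ->
     (forall s, a < s < b -> s \notin E) -> P a b) ->
  lo < hi -> P lo hi.
Proof.
move=> Psplit Pgood lohi.
suff H (F : seq R) a b : lo <= a -> a < b -> b <= hi ->
    (forall s, a < s < b -> s \in E -> s \in F) -> P a b.
  exact: (H E).
elim: F a b => [|e F IH] a b loa ab bhi EF.
  by apply: Pgood => // s sab; apply/negP => /(EF _ sab).
have [/andP[ae eb]|aeb] := boolP (a < e < b).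
  apply: (Psplit _ e _) => //.
    apply: IH => //; first by rewrite (le_trans _ bhi)// ltW.
    move=> s /andP[as_ se] sE; have := EF s; rewrite as_ (lt_trans se eb).
    by move=> /(_ isT sE); rewrite in_cons lt_eqF.
  apply: IH => //; first by rewrite (le_trans loa)// ltW.
  move=> s /andP[es sb] sE; have := EF s; rewrite sb (lt_trans ae es).
  by move=> /(_ isT sE); rewrite in_cons gt_eqF.
apply: IH => // s sab sE; move: (EF s sab sE); rewrite in_cons.
by move=> /predU1P[se|//]; rewrite -se sab in aeb.
Qed.

Lemma nonincreasing_off_finite (R : realType) (E : seq R) (a b : R)
    (f : R -> R) : a <= b ->
  {within `[a, b], continuous f} ->
  (forall s, a < s < b -> s \notin E ->
     exists2 df, is_derive s 1 f df & df <= 0) ->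
  f b <= f a.
Proof.
rewrite le_eqVlt => /predU1P[->//|ab] cf df.
apply: (@interval_split_ind _ E (fun x y => f y <= f x) a b) => //.
  by move=> x y z _ _ _ _ /[swap]; exact: le_trans.
move=> x y ax xy yb nE.
have axy s : s \in `]x, y[ -> a < s < b.
  rewrite in_itv/= => /andP[xs sy].
  by rewrite (le_lt_trans ax xs) (lt_le_trans sy yb).
have dfs s : s \in `]x, y[ -> is_derive s 1 f ('D_1 f s) /\ 'D_1 f s <= 0.
  move=> sxy; have [|d fd d0] := df s (axy _ sxy).
    by apply: nE; rewrite in_itv in sxy.
  by rewrite derive_val; split.
have [||c cxy fE] := @MVT R f (fun s => 'D_1 f s) x y xy.
- by move=> s /dfs[].
- by apply: continuous_subspaceW cf; apply: subset_itv; rewrite bnd_simp.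
- by rewrite -subr_le0 fE pmulr_lle0 ?subr_gt0//; have [] := dfs c cxy.
Qed.

Lemma constant_off_finite (R : realType) (E : seq R) (a b : R)
    (f : R -> R) : a <= b ->
  {within `[a, b], continuous f} ->
  (forall s, a < s < b -> s \notin E -> is_derive s 1 f 0) ->
  f b = f a.
Proof.
move=> ab cf df; apply/eqP; rewrite eq_le; apply/andP; split.
  apply: (nonincreasing_off_finite (E := E)) => // s sab sE.
  by exists 0 => //; exact: df.
rewrite -lerN2; apply: (@nonincreasing_off_finite R E a b (\- f)) => //.
  by move=> x; apply: continuousN; exact: cf.
move=> s sab sE; exists 0 => //; have := df s sab sE => dfs.
by apply: (is_derive_eq (is_deriveN _)); rewrite oppr0.
Qed.

(** The integral of a nonnegative function is the supremum of the integrals of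
    the simple functions below it, so that enlarging the domain enlarges the
    set of competitors whether or not the function is measurable. *)
Lemma ge0_subset_integral_nonmeasurable (R : realType) (A B : set R)
    (f : R -> \bar R) :
  A `<=` B -> (forall x, B x -> (0 <= f x)%E) ->
  (\int[@lebesgue_measure R]_(x in A) f x <=
   \int[@lebesgue_measure R]_(x in B) f x)%E.
Proof.
move=> AB f0; rewrite !ge0_integralE//; last by move=> x /AB; exact: f0.
apply: le_ereal_sup => _ [h hA <-]; exists h => // x.
apply: le_trans (hA x) _; rewrite !patchE.
have [xA|xA] := boolP (x \in A).
  by rewrite mem_set//; apply: AB; rewrite inE in xA.
by case: ifPn => // xB; apply: f0; rewrite inE in xB.
Qed.

(** The derivative may blow up at both ends, so that the fundamental theorem of
    calculus is applied on closed subintervals; these exhaust the open interval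
    and monotone convergence, for which f must be nonnegative, passes to the
    limit. Measurability is part of the conclusion because gluing two intervals
    requires it. *)
Lemma integral_derive_open (R : realType) (a b : R) (f F : R -> R) :
  a < b ->
  {within `[a, b], continuous F} ->
  (forall s, a < s < b -> is_derive s 1 F (f s)) ->
  (forall s, a < s < b -> {for s, continuous f}) ->
  (forall s, a < s < b -> 0 <= f s) ->
  measurable_fun `]a, b[ f /\
  (\int[@lebesgue_measure R]_(s in `]a, b[) (f s)%:E = (F b - F a)%:E)%E.
Proof.
move=> ab cF dF cf f0.
have mf : measurable_fun `]a, b[ f.
  apply: open_continuous_measurable_fun; first exact: interval_open.
  by move=> s; rewrite inE/= in_itv/=; exact: cf.
split=> //.
(* from n.+3 on, the two margins leave an interval of positive length *)
pose d (n : nat) := (b - a) / n.+3%:R.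
have d_gt0 n : 0 < d n by rewrite divr_gt0// subr_gt0.
have d_lt n : a + d n < b - d n.
  rewrite -subr_gt0 (_ : _ - _ = (b - a) * (1 - 2 / n.+3%:R)); last first.
    rewrite /d; have : n.+3%:R != 0 :> R by rewrite pnatr_eq0.
    by move: (n.+3%:R) => c c0; field.
  by rewrite mulr_gt0// subr_gt0// ltr_pdivrMr// mul1r ltr_nat.
have d_cvg0 : d n @[n --> \oo] --> 0.
  have h0 : (n.+3%:R^-1 : R) @[n --> \oo] --> 0.
    have := @cvg_harmonic R; rewrite -(cvg_shiftn 2); apply: cvg_trans.
    by apply: near_eq_cvg; near=> n; rewrite /= addn2.
  by rewrite -(mulr0 (b - a)); apply: cvgM h0; exact: cvg_cst.
pose S n : set R := `[a + d n, b - d n]%classic.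
have Ssub n s : S n s -> a < s < b.
  rewrite /S/= in_itv/= => /andP[s1 s2]; have := d_gt0 n => dn.
  apply/andP; split; lra.
have US : \bigcup_n S n = `]a, b[%classic.
  apply/seteqP; split=> [s [n _ /Ssub]|s]; rewrite /= in_itv//= => /andP[as_ sb].
  have d0 : 0 < Num.min (s - a) (b - s) by rewrite lt_min !subr_gt0 as_.
  have [n _ /(_ n (leqnn n))] := cvgr_lt 0 d_cvg0 _ d0.
  rewrite /= lt_min => /andP[d1 d2]; exists n => //.
  rewrite /S/= in_itv/=; apply/andP; split; lra.
have cvgF c (h : nat -> R) : a <= c <= b -> (forall n, a <= h n <= b) ->
    h n @[n --> \oo] --> c -> F (h n) @[n --> \oo] --> F c.
  move=> acb hab hc; move/subspace_continuousP: cF => /(_ c).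
  rewrite /= in_itv/= => /(_ acb) cFc.
  apply: (cvg_trans _ cFc) => U /= /hc.
  rewrite !nbhs_filterE /=.
  by apply: filterS => n /=; apply; rewrite in_itv/=; exact: hab.
have hI n : (\int[@lebesgue_measure R]_(s in S n) (f s)%:E =
             (F (b - d n) - F (a + d n))%:E)%E.
  apply: continuous_FTC2 => //.
    apply: continuous_in_subspaceT => s; rewrite inE => /Ssub; exact: cf.
    have cFS : {within S n, continuous F}.
      apply: continuous_subspaceW cF => s /Ssub /andP[as_ sb].
      by rewrite /= in_itv/= !ltW.
    have /(continuous_within_itvP _ (d_lt n))[_ FL FR] := cFS.
    split=> // s; rewrite in_itv/= => /andP[s1 s2].
    by have [] : is_derive s 1 F (f s) by apply/dF/(Ssub n); rewrite /S/= in_itv/= !ltW.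
  move=> s; rewrite in_itv/= derive1E => /andP[s1 s2].
  have dFs : is_derive s 1 F (f s) by apply/dF/(Ssub n); rewrite /S/= in_itv/= !ltW.
  by rewrite derive_val.
have : (\int[@lebesgue_measure R]_(s in S n) (f s)%:E)%E @[n --> \oo] -->
       (\int[@lebesgue_measure R]_(s in `]a, b[) (f s)%:E)%E.
  rewrite -US; apply: ge0_nondecreasing_set_cvg_integral.
  - move=> n m nm; rewrite subsetEset => s; rewrite /S/= !in_itv/= => /andP[s1 s2].
    have dmn : d m <= d n by rewrite ler_pM2l ?subr_gt0// lef_pV2 ?posrE// ler_nat.
    by apply/andP; split; lra.
  - by move=> n; exact: measurable_itv.
  - move=> n; apply/measurable_EFinP; apply: measurable_funS mf => //.
    by move=> s /Ssub; rewrite /= in_itv.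
  - by move=> n s /Ssub sab; rewrite lee_fin f0.
under eq_cvg do rewrite hI.
move=> /cvg_unique; apply => //.
apply: cvg_EFin; first by near=> n.
rewrite /=; apply: cvgB; apply: cvgF.
- by rewrite ltW//= lexx.
- by move=> n; have := d_lt n; have := d_gt0 n => ? ?; apply/andP; split; lra.
- by rewrite -[X in _ --> X]subr0; apply: cvgB d_cvg0; exact: cvg_cst.
- by rewrite lexx ltW.
- by move=> n; have := d_lt n; have := d_gt0 n => ? ?; apply/andP; split; lra.
- by rewrite -[X in _ --> X]addr0; apply: cvgD d_cvg0; exact: cvg_cst.
Unshelve. all: by end_near.
Qed.

Lemma integral_derive_off_finite (R : realType) (E : seq R) (a b : R)
    (f F : R -> R) :
  a < b ->
  {within `[a, b], continuous F} ->
  (forall s, a < s < b -> s \notin E -> is_derive s 1 F (f s)) ->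
  (forall s, a < s < b -> s \notin E -> {for s, continuous f}) ->
  (forall s, a <= s <= b -> 0 <= f s) ->
  (\int[@lebesgue_measure R]_(s in `[a, b]) (f s)%:E = (F b - F a)%:E)%E.
Proof.
move=> ab cF dF cf f0.
suff [] : measurable_fun `[a, b] f /\
  (\int[@lebesgue_measure R]_(s in `[a, b]) (f s)%:E = (F b - F a)%:E)%E by [].
apply: (@interval_split_ind R E (fun x y => measurable_fun `[x, y] f /\
  (\int[@lebesgue_measure R]_(s in `[x, y]) (f s)%:E = (F y - F x)%:E)%E)) => //.
  move=> x c y ax xc cy yb [mxc Ixc] [mcy Icy].
  have mcy' : measurable_fun `]c, y] f.
    apply: measurable_funS mcy => // s.
    by rewrite /= !in_itv/= => /andP[/ltW-> ->].
  have xyE : `[x, y]%classic = `[x, c] `|` `]c, y].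
    by rewrite -itv_bndbnd_setU// bnd_simp ltW.
  have mxy : measurable_fun `[x, y] f by rewrite xyE; apply/measurable_funU.
  split=> //; rewrite xyE ge0_integral_setU//=.
  - rewrite integral_itv_obnd_cbnd ?Ixc ?Icy -?EFinD; last exact/measurable_EFinP.
    by congr EFin; ring.
  - by rewrite -xyE; apply/measurable_EFinP.
  - move=> s; rewrite /= !in_itv/= => xsy; rewrite lee_fin f0//.
    by apply/andP; split; lra.
  - by rewrite disj_set2E; apply/eqP/seteqP; split=> // s [] /=; rewrite !in_itv/=; lra.
move=> x y ax xy yb nE.
have sub s : x < s < y -> a < s < b.
  by move=> /andP[xs sy]; rewrite (le_lt_trans ax xs) (lt_le_trans sy yb).
have [||||mf If] := @integral_derive_open R x y f F xy.
- by apply: continuous_subspaceW cF; apply: subset_itv; rewrite bnd_simp.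
- by move=> s sxy; apply: dF; [exact: sub|exact: nE].
- by move=> s sxy; apply: cf; [exact: sub|exact: nE].
- by move=> s /sub /andP[as_ sb]; rewrite f0 ?ltW.
split; first exact: measurable_fun_itv_cc mf.
by rewrite integral_itv_bndoo//; exact/measurable_EFinP.
Qed.

(** * Maximum principle for the transport operator *)

(** Continuity relative to A, used along a path that stays in A: this is what
    transfers the continuity of a solution on the closed time strip to its
    restriction to a curve. *)
Lemma within_continuous_cvg (S T U : topologicalType) (F : set_system S)
    (A : set T) (f : T -> U) (h : S -> T) (p : T) : Filter F ->
  {within A, continuous f} -> A p -> (\forall r \near F, A (h r)) ->
  h r @[r --> F] --> p -> f (h r) @[r --> F] --> f p.
Proof.
move=> FF /subspace_continuousP/(_ p) cf Ap Ah hp; apply: (cvg_trans _ (cf Ap)).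
move=> V /= /hp; rewrite !nbhs_filterE/=.
by move: Ah; apply: filterS2 => r Ahr; apply.
Qed.

Lemma periodic_int (R : realType) (f : R -> R) (m : int) (x : R) :
  periodic f 1 -> f (x + m%:~R) = f x.
Proof.
move=> fp; case: m => n; first by rewrite -pmulrn (periodicn fp).
by rewrite NegzE mulrNz -(periodicn fp n.+1 (x - _)) -pmulrn subrK.
Qed.

(** Maxima over the line are attained on the compact unit interval. *)
Lemma periodic_unit_rep (R : realType) (f : R -> R) (x : R) :
  periodic f 1 -> exists2 y, 0 <= y <= 1 & f x = f y.
Proof.
move=> fp; exists (x - (Num.floor x)%:~R); last first.
  by rewrite -mulrNz periodic_int.
have := Num.Theory.ge_floor x; have := Num.Theory.lt_succ_floor x.
rewrite intrD => x1 x0; apply/andP; split; lra.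
Qed.

Lemma is_derive_right_max_le0 (R : realType) (f : R -> R) (a b df : R) :
  a < b -> is_derive a 1 f df -> (forall t, a < t < b -> f t <= f a) ->
  df <= 0.
Proof.
move=> ab [fa <-] fmax.
rewrite ['D_1 f a]cvg_at_rightE; last exact: fa.
apply: limr_le.
  rewrite -(cvg_at_rightE (fun h : R => h^-1 *: ((f \o shift a) _ - f a))) //.
  apply: cvg_trans fa; apply: cvg_app.
  move=> A [e egt0 Ae]; exists e => // x xe xgt0; apply: Ae => //.
  exact/lt0r_neq0.
near=> h; apply: mulr_ge0_le0; rewrite ?invr_ge0 ?subr_le0 //=.
rewrite [_%:A]mulr1 fmax// ltrDr -ltrBrDr.
apply/andP; split; first by near: h; exact: nbhs_right_gt.
by near: h; apply: nbhs_right_lt; rewrite subr_gt0.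
Unshelve. all: by end_near. Qed.

(** Adding eps (t - e) makes the maximum principle strict. If the perturbed
    function v had a positive maximum over [t0, e] x [0, 1], at time t < e, then
    z_x = 0 there, z_t <= - eps because v(t, x) is maximal among later times,
    and z_t = c z >= 0 because z >= v > 0: a contradiction. Only the sign of the
    right derivative is used, so that the maximum may sit at the initial time
    t0; the time b, where the equation may fail, is reached by continuity. *)
Lemma backward_max_principle_interval (R : realType) (b e : R) (a : R -> R)
    (c z : R -> R -> R) : b < e ->
  (forall t, b <= t <= e -> periodic (z t) 1) ->
  {within [set p : R * R | b <= p.1 <= e],
    continuous (fun p : R * R => z p.1 p.2)} ->
  (forall t x, b < t < e -> 0 <= c t x) ->
  (forall t x, b < t < e -> exists zt zx,
     [/\ is_derive t 1 (fun s => z s x) zt, is_derive x 1 (z t) zx &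
         zt + a x * zx = c t x * z t x]) ->
  (forall x, z e x <= 0) ->
  forall t x, b <= t <= e -> z t x <= 0.
Proof.
move=> be zp cz c0 zeq ze0.
have inner t0 x0 : b < t0 < e -> z t0 x0 <= 0.
  move=> /andP[bt0 t0e].
  apply/ler_addgt0Pr => eps eps0; rewrite add0r.
  (* the slope for which the perturbation is exactly - eps at time t0 *)
  pose eps' := eps / (e - t0).
  have eps'0 : 0 < eps' by rewrite divr_gt0// subr_gt0.
  have [x1 x1_01 ->] : exists2 y, 0 <= y <= 1 & z t0 x0 = z t0 y.
    by apply: periodic_unit_rep; apply: zp; rewrite !ltW.
  pose v (p : R * R) := z p.1 p.2 + eps' * (p.1 - e).
  pose A : set (R * R) := `[t0, e] `*` `[0, 1].
  have A1 : A (t0, x1) by rewrite /A/= !in_itv/= lexx ltW.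
  have cA : compact A by apply: compact_setX; exact: segment_compact.
  have cv : {within A, continuous v}.
    have c1 : {within A, continuous (fun p : R * R => eps' * (p.1 - e))}.
      apply: continuous_subspaceT => q; apply: cvgM; first exact: cvg_cst.
      by apply: cvgB; [exact: cvg_fst|exact: cvg_cst].
    move=> p; apply: cvgD; last exact: c1.
    move: p; apply: continuous_subspaceW cz => -[t x]/=; rewrite /A/= in_itv/=.
    by move=> [/andP[t0t te] _]; rewrite te (le_trans _ t0t)// ltW.
  have [[t x] Atx vmax] := compact_EVT_max (ex_intro _ _ A1) cA cv.
  suff vtx : v (t, x) <= 0.
    have := vmax (t0, x1); rewrite inE => /(_ A1) /le_trans /(_ vtx).
    rewrite /v/= (_ : eps' * _ = - eps) ?subr_le0//.
    by rewrite /eps'; field; rewrite subr_eq0 gt_eqF.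
  rewrite leNgt; apply/negP => vpos.
  move: Atx; rewrite inE /A/= !in_itv/= => -[/andP[t0t te] x01].
  have {te}te : t < e.
    rewrite lt_neqAle te andbT; apply/eqP => tE.
    by move: vpos; rewrite /v/= tE subrr mulr0 addr0 ltNge ze0.
  have bte : b < t < e by rewrite te (lt_le_trans bt0 t0t).
  have zpos : 0 < z t x.
    apply: (lt_le_trans vpos); rewrite /v/= gerDl pmulr_rle0// subr_le0 ltW//.
  have [zt [zx [dzt dzx zE]]] := zeq t x bte.
  have zpt : periodic (z t) 1 by apply: zp; case/andP: bte => ? ?; rewrite !ltW.
  have zmax y : z t y <= z t x.
    have [y' y'01 ->] := periodic_unit_rep y zpt.
    have := vmax (t, y'); rewrite inE /A/= !in_itv/= t0t (ltW te).
    by move=> /(_ (conj isT y'01)); rewrite /v/= lerD2r.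
  have zx0 : zx = 0.
    have x11 : x - 1 <= x + 1 by lra.
    have dz0 : is_derive x 1 (z t) 0.
      apply: (derive1_at_max x11) => //.
        by move=> y _; have [_ [? [_ [? _] _]]] := zeq t y bte.
      by rewrite in_itv/=; apply/andP; split; lra.
    by rewrite -(@derive_val _ _ _ _ _ _ _ dzx) (@derive_val _ _ _ _ _ _ _ dz0).
  have ztneg : zt + eps' <= 0.
    apply: (@is_derive_right_max_le0 _ (fun s => v (s, x)) t e) => //.
      by rewrite /v/=; apply: is_derive_eq; rewrite subr0 scaler1 /GRing.scale/=; ring.
    move=> s /andP[ts se]; apply: vmax.
    by rewrite inE /A/= !in_itv/= (ltW se) (le_trans t0t)// ltW.
  move: zE; rewrite zx0 mulr0 addr0 => zE.
  have : 0 <= zt by rewrite zE mulr_ge0 ?c0// ltW.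
  lra.
move=> t x /andP[bt te].
have [->//|tne] := eqVneq t e.
have {}te : t < e by rewrite lt_neqAle tne.
have [tb|tb] := eqVneq t b; last first.
  by apply: inner; rewrite te lt_neqAle eq_sym tb bt.
rewrite {}tb in te *; rewrite leNgt; apply/negP => zbx.
have czbx : z r x @[r --> b^'+] --> z b x.
  apply: (@within_continuous_cvg _ _ _ _ _ _ (fun r => (r, x)) (b, x) _ cz) => /=.
  - by rewrite lexx ltW.
  - near=> r; apply/andP; split; near: r.
      exact: nbhs_right_ge.
    exact: nbhs_right_le.
  - have rb : r @[r --> b^'+] --> b by exact: cvg_within.
    have xb : (cst x : R -> R) r @[r --> b^'+] --> x by exact: cvg_cst.
    exact: (@cvg_pair _ _ _ _ (nbhs b) (nbhs x) _ _ _ id (cst x) rb xb).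
have [r [rb zr]] : exists r, b < r < e /\ 0 < z r x.
  near (b^'+) => r; exists r; split; last by near: r; apply: (cvgr_gt (z b x) czbx).
  apply/andP; split; near: r; [exact: nbhs_right_gt|exact: nbhs_right_lt].
by move: zr; rewrite ltNge inner.
Unshelve. all: by end_near.
Qed.

Lemma backward_max_principle (R : realType) (T : R) (E : seq R) (a : R -> R)
    (c z : R -> R -> R) : 0 < T ->
  (forall t, 0 <= t <= T -> periodic (z t) 1) ->
  {within [set p : R * R | 0 <= p.1 <= T],
    continuous (fun p : R * R => z p.1 p.2)} ->
  (forall t x, 0 < t < T -> 0 <= c t x) ->
  (forall t x, 0 < t < T -> t \notin E -> exists zt zx,
     [/\ is_derive t 1 (fun s => z s x) zt, is_derive x 1 (z t) zx &
         zt + a x * zx = c t x * z t x]) ->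
  (forall x, z T x <= 0) ->
  forall t x, 0 <= t <= T -> z t x <= 0.
Proof.
move=> T0 zp cz c0 zeq.
apply: (@interval_split_ind R E (fun b e => (forall x, z e x <= 0) ->
  forall t x, b <= t <= e -> z t x <= 0)) => //.
  move=> b m e _ _ me _ Hbm Hme ze t x /andP[bt te].
  have [mt|tm] := leP m t; first by apply: Hme; rewrite // mt.
  apply: Hbm; last by rewrite bt ltW.
  by move=> y; apply: Hme => //; rewrite lexx ltW.
move=> b e b0 be eT nE; apply: (@backward_max_principle_interval _ _ _ a c) => //.
- by move=> t tbe; apply: zp; apply/andP; split; lra.
- by apply: continuous_subspaceW cz => -[t x]/= tbe; apply/andP; split; lra.
- by move=> t x tbe; apply: c0; apply/andP; split; lra.
- by move=> t x tbe; apply: zeq; [apply/andP; split; lra|exact: nE].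
Qed.

(** * Gains depending on time only *)

Lemma transport_solution_ext (R : realType) (T : R) (a : R -> R)
    (f g u : R -> R -> R) :
  (forall t x, 0 <= t <= T -> f t x = g t x) ->
  transport_solution T a f u -> transport_solution T a g u.
Proof.
move=> fg [up uc ub [E uE]]; split=> //; exists E => t tT tE.
have [ueq udx] := uE t tT tE; split=> // x; have [uC1 ->] := ueq x.
by rewrite fg//; case/andP: tT => *; rewrite !ltW.
Qed.

Lemma is_derive_derive1 (R : realType) (f : R -> R) (x : R) :
  derivable f x 1 -> is_derive x 1 f (derive1 f x).
Proof. by rewrite derive1E => /derivableP. Qed.

Lemma C1_at_is_derive (R : realType) (u : R -> R -> R) (t x : R) :
  C1_at u t x ->
  is_derive t 1 (fun s => u s x) (dt u t x) /\ is_derive x 1 (u t) (dx u t x).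
Proof.
by move=> [ut ux _ _]; split; exact: is_derive_derive1.
Qed.

(** The difference wt - w theta and its opposite both satisfy the hypotheses of
    the backward maximum principle, with coefficient c = kappa g. *)
Lemma nudging_time_dependent_gain (R : realType) (T kappa : R) (a : R -> R)
    (g theta : R -> R) (E : seq R) (uobs u ut : R -> R -> R) :
  0 < T -> 0 < kappa ->
  (forall t, 0 <= t <= T -> 0 <= g t) ->
  transport_solution T a (fun _ _ => 0) uobs ->
  transport_solution T a (fun t x => - g t * (u t x - uobs t x)) u ->
  transport_solution T a (fun t x => kappa * g t * (ut t x - uobs t x)) ut ->
  (forall x, ut T x = u T x) ->
  continuous theta -> theta T = 1 ->
  (forall t, 0 < t < T -> t \notin E ->
     is_derive t 1 theta ((1 + kappa) * g t * theta t)) ->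
  forall t x, 0 <= t <= T ->
    ut t x - uobs t x = (u t x - uobs t x) * theta t.
Proof.
move=> T0 kappa0 g0 [op oc _ [Eo oE]] [up uc _ [Eu uE]] [tp tc _ [Et tE]].
move=> utT ctheta thetaT dtheta.
pose z t x := ut t x - uobs t x - (u t x - uobs t x) * theta t.
have zp t : 0 <= t <= T -> periodic (z t) 1.
  by move=> tT x; rewrite /z op// up// tp.
have cz : {within [set p : R * R | 0 <= p.1 <= T],
    continuous (fun p : R * R => z p.1 p.2)}.
  have ct : {within [set p : R * R | 0 <= p.1 <= T],
      continuous (fun p : R * R => theta p.1)}.
    apply: continuous_subspaceT => p; apply: continuous_comp; first exact: cvg_fst.
    exact: ctheta.
  move=> p; rewrite /z; apply: cvgB; first by apply: cvgB; [exact: tc|exact: oc].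
  by apply: cvgM; [apply: cvgB; [exact: uc|exact: oc]|exact: ct].
pose F := Eo ++ Eu ++ Et ++ E.
have zeq t x : 0 < t < T -> t \notin F -> exists zt zx,
    [/\ is_derive t 1 (fun s => z s x) zt, is_derive x 1 (z t) zx &
        zt + a x * zx = kappa * g t * z t x].
  move=> tT; rewrite !mem_cat !negb_or => /and4P[to tu tt te].
  have [/(_ x)[/C1_at_is_derive[ot ox] oeq] _] := oE t tT to.
  have [/(_ x)[/C1_at_is_derive[u_t u_x] ueq] _] := uE t tT tu.
  have [/(_ x)[/C1_at_is_derive[t_t t_x] teq] _] := tE t tT tt.
  have dth := dtheta t tT te.
  exists (dt ut t x - dt uobs t x - ((dt u t x - dt uobs t x) * theta t +
    (u t x - uobs t x) * ((1 + kappa) * g t * theta t))).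
  exists (dx ut t x - dx uobs t x - (dx u t x - dx uobs t x) * theta t).
  split.
  - by apply: is_derive_eq; rewrite /GRing.scale/=; ring.
  - by apply: is_derive_eq; rewrite /GRing.scale/=; ring.
  move/(canRL (addrK _)): oeq => ->; move/(canRL (addrK _)): ueq => ->.
  by move/(canRL (addrK _)): teq => ->; rewrite /z; ring.
have c0 t (x : R) : 0 < t < T -> 0 <= kappa * g t.
  move=> /andP[t0 tT]; apply: mulr_ge0; first exact: ltW.
  by apply: g0; rewrite !ltW.
have zT x : z T x = 0 by rewrite /z utT thetaT mulr1 subrr.
move=> t x tT; apply/eqP; rewrite -subr_eq0 -/(z t x) eq_le; apply/andP; split.
  apply: (backward_max_principle T0 zp cz c0 zeq) => // y.
  by rewrite zT.
rewrite -oppr_le0.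
apply: (@backward_max_principle R T F a (fun t _ => kappa * g t)
  (fun t x => - z t x)) => //.
- by move=> s sT y; rewrite zp.
- by move=> p; apply: cvgN; exact: cz.
- move=> s y sT sF; have [zt [zx [dzt dzx zE]]] := zeq s y sT sF.
  exists (- zt), (- zx); split; [exact: is_deriveN|exact: is_deriveN|].
  by rewrite !mulrN -opprD zE.
- by move=> y; rewrite zT oppr0.
Qed.

(** The time spent in the window [t1, t2] after s is t2 - max t1 (min s t2); it
    is differentiable except at the two ends of the window. *)
Lemma is_derive_window_weight (R : realType) (C t1 t2 t : R) :
  t1 < t2 -> t \notin [:: t1; t2] ->
  is_derive t 1 (fun s => expR (- C * (t2 - Num.max t1 (Num.min s t2))))
    (C * \1_(`[t1, t2]%classic) t *
     expR (- C * (t2 - Num.max t1 (Num.min t t2)))).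
Proof.
move=> t12; rewrite !inE negb_or => /andP[tt1 tt2].
have out_deriv c : (\forall s \near t, c = Num.max t1 (Num.min s t2)) ->
    ~ (t1 <= t <= t2) ->
    is_derive t 1 (fun s => expR (- C * (t2 - Num.max t1 (Num.min s t2))))
    (C * \1_(`[t1, t2]%classic) t *
     expR (- C * (t2 - Num.max t1 (Num.min t t2)))).
  move=> cE tout.
  rewrite indicE memNset ?mulr0 ?mul0r; last by rewrite /= in_itv.
  apply: (@near_eq_is_derive _ _ _ (cst (expR (- C * (t2 - c))))).
  near=> s; rewrite /cst (_ : Num.max t1 (Num.min s t2) = c)//.
  by apply/esym; near: s.
have [t_lt|] := boolP (t < t1).
  apply: (out_deriv t1); last by apply/negP; rewrite negb_and -ltNge t_lt.
  near=> s; have st1 : s < t1 by near: s; exact: lt_nbhsl.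
  by rewrite min_l ?max_l// ltW// (lt_trans st1).
rewrite -leNgt => t1_le; have [t2_lt|] := boolP (t2 < t).
  apply: (out_deriv t2); last by apply/negP; rewrite negb_and -!ltNge t2_lt orbT.
  near=> s; have st2 : t2 < s by near: s; exact: lt_nbhsr.
  by rewrite min_r ?max_r// ltW.
rewrite -leNgt => t_le; have {t1_le}t1_lt : t1 < t by rewrite lt_neqAle eq_sym tt1.
have {t_le}t_lt : t < t2 by rewrite lt_neqAle tt2.
rewrite indicE mem_set ?mulr1; last by rewrite /= in_itv/= !ltW.
rewrite (min_l (ltW t_lt)) (max_r (ltW t1_lt)).
apply: (@near_eq_is_derive _ _ _ (fun s => expR (- C * (t2 - s)))).
  near=> s; have s1 : t1 < s by near: s; exact: lt_nbhsr.
  have s2 : s < t2 by near: s; exact: lt_nbhsl.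
  by rewrite (min_l (ltW s2)) (max_r (ltW s1)).
by apply: is_derive_eq; rewrite /GRing.scale/=; ring.
Unshelve. all: by end_near. Qed.

(** * Transport along characteristics *)

(** The mean value theorem without an order on the two points, as is needed for
    a two-sided difference quotient. *)
Lemma MVT_between (R : realType) (f : R -> R) (a b : R) :
  (forall q, `|q - a| <= `|b - a| -> derivable f q 1) ->
  exists2 c, `|c - a| <= `|b - a| & f b - f a = derive1 f c * (b - a).
Proof.
move=> df.
have dab q : `|q - a| <= `|b - a| -> is_derive q 1 f (derive1 f q).
  by move=> /df/is_derive_derive1.
have cont (x y : R) : (forall q, q \in `[x, y] -> `|q - a| <= `|b - a|) ->
    {within `[x, y], continuous f}.
  by move=> xy; apply: derivable_within_continuous => q /xy/df.
have [ab|ba] := leP a b.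
  have close q : q \in `[a, b] -> `|q - a| <= `|b - a|.
    rewrite in_itv/= => /andP[aq qb].
    by rewrite !ger0_norm ?subr_ge0// lerB.
  have [c cab fE] := MVT_segment ab
    (fun q qab => dab q (close q (subset_itv_oo_cc qab))) (cont _ _ close).
  by exists c => //; exact: close.
have close q : q \in `[b, a] -> `|q - a| <= `|b - a|.
  rewrite in_itv/= => /andP[bq qa].
  by rewrite !ler0_norm ?subr_le0// ?(ltW ba)// lerN2 lerB.
have [c cab fE] := MVT_segment (ltW ba)
  (fun q qab => dab q (close q (subset_itv_oo_cc qab))) (cont _ _ close).
exists c; first exact: close.
by rewrite -opprB fE -mulrN opprB.
Qed.

(** A chain rule for partial rather than total derivatives. The increment splits into
    a time increment at the moved point y(r), handled by the mean value theorem
    and the joint continuity of u_t, and a space increment at the fixed time s,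
    which is a one-variable composition. *)
Lemma is_derive_along (R : realType) (u : R -> R -> R) (y : R -> R)
    (s v : R) :
  is_derive s 1 y v ->
  (\forall r \near s, forall x, derivable (fun q => u q x) r 1) ->
  derivable (u s) (y s) 1 ->
  {for (s, y s), continuous (fun p : R * R => dt u p.1 p.2)} ->
  is_derive s 1 (fun r => u r (y r)) (dt u s (y s) + v * dx u s (y s)).
Proof.
move=> dy dut dux cdt.
have cy : {for s, continuous y}.
  by apply/differentiable_continuous/derivable1_diffP; case: dy.
pose g r := u r (y r) - u s (y r).
have dg : is_derive s 1 g (dt u s (y s)).
  suff gl : h^-1 *: (g (h *: 1 + s) - g s) @[h --> 0^'] --> dt u s (y s).
    by apply: DeriveDef; [apply/cvg_ex; exists (dt u s (y s))|exact: cvg_lim gl].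
  apply/cvgrPdist_le => e e0.
  have ypair : (fun p : R * R => (p.1, y p.2)) @ (s, s) --> (s, y s).
    have c1 : (fun p : R * R => p.1) @ (s, s) --> s by exact: cvg_fst.
    have c2 : (fun p : R * R => y p.2) @ (s, s) --> y s.
      by apply: continuous_comp; [exact: cvg_snd|exact: cy].
    exact: (@cvg_pair _ _ _ _ (nbhs s) (nbhs (y s)) _ _ _ _ _ c1 c2).
  have : \forall p \near (s, s), `|dt u s (y s) - dt u p.1 (y p.2)| <= e.
    by move: (cvg_comp _ _ ypair cdt) => /cvgrPdist_le/(_ e e0).
  move=> /nbhs_ballP[d1 /= d1_0 d1A].
  have /nbhs_ballP[d2 /= d2_0 d2A] := dut.
  near=> h.
  have h0 : h != 0 by near: h; exact: nbhs_dnbhs_neq.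
  have hd : `|h| < Num.min d1 d2.
    near: h; apply: dnbhs0_lt; by rewrite lt_min d1_0.
  move: hd; rewrite lt_min => /andP[hd1 hd2].
  have hE : h *: 1 + s = s + h by rewrite /GRing.scale/= mulr1 addrC.
  rewrite hE /g subrr subr0.
  have [q|c cs] := @MVT_between _ (fun r => u r (y (s + h))) s (s + h).
    rewrite (addrC s) addrK => qh; apply: d2A.
    by rewrite -ball_normE/= distrC (le_lt_trans qh).
  rewrite (addrC s) addrK -(addrC s) => ->; rewrite /GRing.scale/= mulrC mulfK//.
  apply: (d1A (c, s + h)); split; rewrite -ball_normE/=.
    by rewrite distrC (le_lt_trans cs)// (addrC s) addrK.
  by rewrite distrC (addrC s) addrK.
have du : is_derive s 1 (fun r => u s (y r)) (dx u s (y s) * v).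
  have dus : is_derive (y s) 1 (u s) (dx u s (y s)).
    exact: is_derive_derive1.
  exact: (@is_derive1_comp _ (u s) y).
have -> : (fun r => u r (y r)) = g + (fun r => u s (y r)).
  by apply/funext => r; rewrite /g /= fctE subrK.
by rewrite (mulrC v); exact: is_deriveD.
Unshelve. all: by end_near.
Qed.

Lemma near_notin_seq (R : realType) (E : seq R) (s : R) :
  s \notin E -> \forall r \near s, r \notin E.
Proof.
elim: E => [|e E IH]; first by move=> _; near=> r.
rewrite in_cons negb_or => /andP[se /IH sE]; near=> r.
rewrite in_cons negb_or; apply/andP; split; last by near: r.
near: r; apply/nbhs_ballP; exists `|s - e|; first by rewrite /= normr_gt0 subr_eq0.
move=> r; rewrite -ball_normE/=; apply: contraTneq => ->.
by rewrite ltxx.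
Unshelve. all: by end_near. Qed.

(** Along a characteristic the transport operator becomes d/ds. The forcing is
    continuous along the curve because the left-hand side of the equation is;
    this regularity passes to the gain wherever the error does not vanish. *)
Lemma transport_solution_along (R : realType) (T : R) (a : R -> R)
    (f u psi : R -> R -> R) (x : R) :
  continuous a ->
  transport_solution T a f u -> characteristics T a psi ->
  {within `[0, T], continuous (fun s => u s (psi s x))} /\
  exists E : seq R, forall s, 0 < s < T -> s \notin E ->
    is_derive s 1 (fun r => u r (psi r x)) (f s (psi s x)) /\
    {for s, continuous (fun r => f r (psi r x))}.
Proof.
move=> ca [_ uc _ [E uE]] [_ cpsi dpsi]; split.
  apply/subspace_continuousP => s sT.
  apply: (@within_continuous_cvg _ _ _ _ _ _ (fun r => (r, psi r x))
    (s, psi s x) _ uc) => /=.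
  - by rewrite /= in_itv/= in sT.
  - have : \forall r \near within `[0, T] (nbhs s), `[0, T]%classic r.
      exact: withinT.
    by apply: filterS => r /=; rewrite in_itv.
  - have c1 : r @[r --> within `[0, T] (nbhs s)] --> s by exact: cvg_within.
    have c2 : psi r x @[r --> within `[0, T] (nbhs s)] --> psi s x.
      by move/subspace_continuousP: (cpsi x); exact.
    exact: (@cvg_pair _ _ _ _ (nbhs s) (nbhs (psi s x)) _ _ _ _ _ c1 c2).
exists E => s sT sE.
have near_good : \forall r \near s, 0 < r < T /\ r \notin E.
  case/andP: (sT) => s0 sltT.
  have near0 := lt_nbhsr s0; have nearT := lt_nbhsl sltT.
  have nearE := near_notin_seq sE.
  by near=> r; split; [apply/andP; split|]; near: r.
have [/(_ (psi s x))[[ut ux cdt cdx] ueq] _] := uE s sT sE.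
have dps := dpsi x s sT.
have cpsis : {for s, continuous (fun r => psi r x)}.
  by apply/differentiable_continuous/derivable1_diffP; case: dps.
split.
  rewrite -ueq; apply: is_derive_along => //.
  near=> r => y; have [rT rE] : 0 < r < T /\ r \notin E by near: r.
  by have [/(_ y)[[]]] := uE r rT rE.
have cpair : (r, psi r x) @[r --> s] --> (s, psi s x).
  have c1 : r @[r --> s] --> s by exact: cvg_id.
  exact: (@cvg_pair _ _ _ _ (nbhs s) (nbhs (psi s x)) _ _ _ _ _ c1 cpsis).
have cg : dt u r (psi r x) + a (psi r x) * dx u r (psi r x) @[r --> s] -->
    f s (psi s x).
  rewrite -ueq; apply: cvgD; first exact: (cvg_comp _ _ cpair cdt).
  apply: cvgM; last exact: (cvg_comp _ _ cpair cdx).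
  exact: (cvg_comp _ _ cpsis (ca _)).
apply: cvg_trans cg; apply: near_eq_cvg; near=> r.
have [rT rE] : 0 < r < T /\ r \notin E by near: r.
by have [/(_ (psi r x))[_ ->]] := uE r rT rE.
Unshelve. all: by end_near. Qed.

(** * Damped and amplified linear equations *)

Lemma within_continuous_ln_sqr (R : realType) (b e : R) (W : R -> R) :
  {within `[b, e], continuous W} ->
  (forall s, b <= s <= e -> W s != 0) ->
  {within `[b, e], continuous (fun s => ln (W s ^+ 2))}.
Proof.
move=> /subspace_continuousP cW W0; apply/subspace_continuousP => s sbe.
have W2 : 0 < W s ^+ 2 by rewrite exprn_even_gt0//= W0//; rewrite /= in_itv in sbe.
have cW2 : W r ^+ 2 @[r --> within `[b, e] (nbhs s)] --> W s ^+ 2.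
  by rewrite !expr2; apply: cvgM; exact: cW.
exact: (cvg_comp _ _ cW2 (continuous_ln W2)).
Qed.

(** ln(W^2) replaces ln|W|, whose absolute value would need a case analysis on
    the sign. *)
Lemma is_derive_ln_sqr (R : realType) (k W : R -> R) (s : R) :
  W s != 0 -> is_derive s 1 W (- k s * W s) ->
  is_derive s 1 (fun r => ln (W r ^+ 2)) (- (2 * k s)).
Proof.
move=> W0 dW.
have W2 : 0 < W s ^+ 2 by rewrite exprn_even_gt0//= W0.
have dW2 : is_derive s 1 (fun r => W r ^+ 2) (- (2 * k s) * W s ^+ 2).
  by apply: is_derive_eq; rewrite /GRing.scale/=; ring.
have dln := is_derive1_ln W2.
apply: (is_derive_eq (@is_derive1_comp R (@ln R) (fun r => W r ^+ 2) s _ _ dln dW2)).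
by field.
Qed.

(** Since ln(W^2) is a primitive of - 2 k, the function exp(c/2 ln(W^2)) is an
    integrating factor for X' = c k X, even when k has no other known primitive.
    It is used with X = W (c = - 1) and X = V (c = kappa). *)
Lemma linear_ode_log_invariant (R : realType) (b e c : R) (E : seq R)
    (k W X : R -> R) : b <= e ->
  {within `[b, e], continuous W} -> {within `[b, e], continuous X} ->
  (forall s, b <= s <= e -> W s != 0) ->
  (forall s, b < s < e -> s \notin E -> is_derive s 1 W (- k s * W s)) ->
  (forall s, b < s < e -> s \notin E -> is_derive s 1 X (c * k s * X s)) ->
  X e * expR (c / 2 * ln (W e ^+ 2)) = X b * expR (c / 2 * ln (W b ^+ 2)).
Proof.
move=> be cW cX W0 dW dX.
pose G s := X s * expR (c / 2 * ln (W s ^+ 2)).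
apply: (@constant_off_finite R E b e G be).
  have cL := within_continuous_ln_sqr cW W0.
  move=> s; apply: cvgM; first exact: cX.
  apply: continuous_comp; last exact: continuous_expR.
  by apply: cvgM; [exact: cvg_cst|exact: cL].
move=> s sbe sE; have dXs := dX s sbe sE.
have [b_s s_e] := andP sbe.
have dL := is_derive_ln_sqr (W0 s ltac:(by rewrite !ltW)) (dW s sbe sE).
by rewrite /G; apply: is_derive_eq; rewrite /GRing.scale/=; field.
Qed.

(** Where W does not vanish, k = - W' / W is continuous off the exceptional times,
    because k W is; its primitive is read off ln(W^2). *)
Lemma integral_gain_log (R : realType) (b e kappa : R) (E : seq R)
    (k W : R -> R) : b < e -> 0 <= kappa ->
  {within `[b, e], continuous W} ->
  (forall s, b <= s <= e -> W s != 0) ->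
  (forall s, b <= s <= e -> 0 <= k s) ->
  (forall s, b < s < e -> s \notin E -> is_derive s 1 W (- k s * W s)) ->
  (forall s, b < s < e -> s \notin E -> {for s, continuous (fun r => - k r * W r)}) ->
  (\int[@lebesgue_measure R]_(s in `[b, e]) (k s + kappa * k s)%:E =
   ((1 + kappa) / 2 * (ln (W b ^+ 2) - ln (W e ^+ 2)))%:E)%E.
Proof.
move=> be kappa0 cW W0 k0 dW ckW.
pose F s := - ((1 + kappa) / 2 * ln (W s ^+ 2)).
have -> : (1 + kappa) / 2 * (ln (W b ^+ 2) - ln (W e ^+ 2)) = F e - F b.
  by rewrite /F; ring.
apply: (@integral_derive_off_finite R E b e (fun s => k s + kappa * k s) F be).
- have cL := within_continuous_ln_sqr cW W0.
  by move=> s; rewrite /F; apply: cvgN; apply: cvgM; [exact: cvg_cst|exact: cL].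
- move=> s sbe sE; have [b_s s_e] := andP sbe.
  have dL := is_derive_ln_sqr (W0 s ltac:(by rewrite !ltW)) (dW s sbe sE).
  by rewrite /F; apply: is_derive_eq; rewrite /GRing.scale/=; field.
- move=> s sbe sE; have [b_s s_e] := andP sbe.
  have dWs := dW s sbe sE.
  have Ws0 : W s != 0 by apply: W0; rewrite !ltW.
  have cWs : {for s, continuous W}.
    by apply/differentiable_continuous/derivable1_diffP; case: dWs.
  have ck : k r @[r --> s] --> k s.
    have : - ((- k r * W r) / W r) @[r --> s] --> - ((- k s * W s) / W s).
      by apply: cvgN; apply: cvgM; [exact: ckW|exact: cvgV].
    rewrite mulfK// opprK; apply: cvg_trans; apply: near_eq_cvg; near=> r.
    rewrite mulfK ?opprK// W0//; apply/andP; split; near: r.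
      exact: lt_le_nbhsr.
    exact: lt_le_nbhsl.
  by apply: cvgD => //; apply: cvgM => //; exact: cvg_cst.
- by move=> s sbe; rewrite addr_ge0 ?mulr_ge0 ?k0.
Unshelve. all: by end_near. Qed.

Lemma sqr_nonincreasing_damped (R : realType) (b e : R) (E : seq R)
    (k W : R -> R) : b <= e ->
  {within `[b, e], continuous W} ->
  (forall s, b <= s <= e -> 0 <= k s) ->
  (forall s, b < s < e -> s \notin E -> is_derive s 1 W (- k s * W s)) ->
  W e ^+ 2 <= W b ^+ 2.
Proof.
move=> be cW k0 dW.
apply: (nonincreasing_off_finite (f := fun s => W s ^+ 2) (E := E) be).
  by move=> s; exact: (cvgM (cW s) (cW s)).
move=> s sbe sE; have dWs := dW s sbe sE.
exists (- (2 * k s * W s ^+ 2)).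
  by apply: is_derive_eq; rewrite /GRing.scale/=; ring.
have [b_s s_e] := andP sbe.
by rewrite oppr_le0 mulr_ge0 ?sqr_ge0// mulr_ge0// k0// !ltW.
Qed.

Lemma sqr_nondecreasing_amplified (R : realType) (b e : R) (E : seq R)
    (k V : R -> R) : b <= e ->
  {within `[b, e], continuous V} ->
  (forall s, b <= s <= e -> 0 <= k s) ->
  (forall s, b < s < e -> s \notin E -> is_derive s 1 V (k s * V s)) ->
  V b ^+ 2 <= V e ^+ 2.
Proof.
move=> be cV k0 dV; rewrite -lerN2.
apply: (nonincreasing_off_finite (f := fun s => - V s ^+ 2) (E := E) be).
  by move=> s; apply: cvgN; exact: (cvgM (cV s) (cV s)).
move=> s sbe sE; have dVs := dV s sbe sE.
exists (- (2 * k s * V s ^+ 2)).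
  by apply: is_derive_eq; rewrite /GRing.scale/=; ring.
have [b_s s_e] := andP sbe.
by rewrite oppr_le0 mulr_ge0 ?sqr_ge0// mulr_ge0// k0// !ltW.
Qed.


(** The ratio of the amplified to the damped solution, allowing a gain whose
    integral diverges: then W reaches 0 and both sides are 0. *)
Lemma damped_amplified_ratio (R : realType) (b e kappa : R) (E : seq R)
    (k W V : R -> R) : b <= e -> 0 <= kappa ->
  {within `[b, e], continuous W} -> {within `[b, e], continuous V} ->
  (forall s, b <= s <= e -> 0 <= k s) ->
  (forall s, b < s < e -> s \notin E -> is_derive s 1 W (- k s * W s)) ->
  (forall s, b < s < e -> s \notin E -> is_derive s 1 V (kappa * k s * V s)) ->
  (forall s, b < s < e -> s \notin E -> {for s, continuous (fun r => - k r * W r)}) ->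
  V e = W e ->
  ((V b)%:E = (W b)%:E *
   expeR (- \int[@lebesgue_measure R]_(s in `[b, e]) (k s + kappa * k s)%:E))%E.
Proof.
rewrite le_eqVlt => /predU1P[<- *|be kappa0 cW cV k0 dW dV ckW VW].
  by rewrite set_itv1 integral_set1 oppe0 expeR0 mule1; congr EFin.
have sub s : b <= s <= e -> {within `[b, s], continuous W}.
  move=> /andP[_ se]; apply: continuous_subspaceW cW => r.
  by rewrite /= !in_itv/= => /andP[-> /le_trans]; exact.
have W0 s : b <= s <= e -> W s != 0 -> forall r, b <= r <= s -> W r != 0.
  move=> /andP[bs se] Ws0 r /andP[br rs].
  rewrite -sqrf_eq0 gt_eqF//.
  apply: (@lt_le_trans _ _ (W s ^+ 2)); first by rewrite exprn_even_gt0.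
  apply: (@sqr_nonincreasing_damped R r s E k W rs).
  - apply: continuous_subspaceW cW => q; rewrite /= !in_itv/= => /andP[? ?].
    by apply/andP; split; lra.
  - by move=> q /andP[? ?]; apply: k0; apply/andP; split; lra.
  - by move=> q /andP[? ?]; apply: dW; apply/andP; split; lra.
have int_bs s : b < s -> s <= e -> W s != 0 ->
    (\int[@lebesgue_measure R]_(q in `[b, s]) (k q + kappa * k q)%:E =
     ((1 + kappa) / 2 * (ln (W b ^+ 2) - ln (W s ^+ 2)))%:E)%E.
  move=> bs se Ws0; have bse : b <= s <= e by rewrite ltW.
  apply: (@integral_gain_log R b s kappa E k W).
  - exact: bs.
  - exact: kappa0.
  - exact: sub.
  - exact: W0.
  - by move=> q /andP[? ?]; apply: k0; apply/andP; split; lra.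
  - by move=> q /andP[? ?]; apply: dW; apply/andP; split; lra.
  - by move=> q /andP[? ?]; apply: ckW; apply/andP; split; lra.
have [We0|We0] := eqVneq (W e) 0; last first.
  have bee : b <= e <= e by rewrite lexx ltW.
  (* compare ln(W^2) at both ends: the integrating factors of V and of W,
     with V e = W e, determine V b from W b *)
  rewrite int_bs// -EFinN /= -EFinM; congr EFin.
  have invV := linear_ode_log_invariant (ltW be) cW cV (W0 _ bee We0) dW dV.
  have dW1 s : b < s < e -> s \notin E -> is_derive s 1 W (- 1 * k s * W s).
    by rewrite mulN1r; exact: dW.
  have invW := linear_ode_log_invariant (ltW be) cW cW (W0 _ bee We0) dW dW1.
  move: invV invW; rewrite VW.
  set x := ln (W b ^+ 2); set y := ln (W e ^+ 2) => invV invW.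
  apply: (@mulIf _ (expR (kappa / 2 * x))); first by rewrite gt_eqF ?expR_gt0.
  rewrite -invV.
  apply: (@mulIf _ (expR (-1 / 2 * y))); first by rewrite gt_eqF ?expR_gt0.
  rewrite mulrAC invW -!mulrA -!expRD; congr (_ * expR _).
  by field.
have Vb0 : V b = 0.
  apply/eqP; rewrite -sqrf_eq0 eq_le sqr_ge0 andbT.
  have -> : 0 = V e ^+ 2 by rewrite VW We0 expr0n.
  apply: (@sqr_nondecreasing_amplified R b e E (fun s => kappa * k s) V).
  - exact: ltW.
  - exact: cV.
  - by move=> s sbe; rewrite mulr_ge0 ?k0.
rewrite Vb0.
have [Wb0|Wb0] := eqVneq (W b) 0; first by rewrite Wb0 mul0e.
rewrite (_ : integral _ _ _ = +oo%E) /= ?mule0//.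
apply/eqyP => M M0.
(* by the intermediate value theorem W shrinks by the factor exp(- M) before
   vanishing, and up to that point the integral is (1 + kappa) M >= M *)
have [s sbe Ws] : exists2 s, s \in `[b, e] & W s = W b * expR (- M).
  apply: IVT => //; first exact: ltW.
  have e1 : 0 < expR (- M) < 1 by rewrite expR_gt0 expR_lt1 oppr_lt0.
  move: e1 => /andP[p0 p1]; rewrite We0.
  rewrite minC maxC; have [Wpos|Wneg] := ltP 0 (W b); apply/andP; split; nra.
move: sbe; rewrite in_itv/= => /andP[bs se].
have Ws0 : W s != 0 by rewrite Ws mulf_neq0// gt_eqF ?expR_gt0.
have {}bs : b < s.
  rewrite lt_neqAle bs andbT; apply/eqP => bsE; move: Ws; rewrite -bsE.
  move/eqP; rewrite -[X in X == _]mulr1 (inj_eq (mulfI Wb0)) eq_sym.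
  by rewrite lt_eqF ?expR_lt1 ?oppr_lt0.
apply: (@le_trans _ _
  (\int[@lebesgue_measure R]_(q in `[b, s]) (k q + kappa * k q)%:E)%E).
  have Wb2 : 0 < W b ^+ 2 by rewrite exprn_even_gt0.
  have eM2 : 0 < expR (- M) ^+ 2 by rewrite exprn_gt0 ?expR_gt0.
  have lnWs : ln (W s ^+ 2) = ln (W b ^+ 2) - 2 * M.
    by rewrite Ws exprMn lnM ?posrE// [expR _ ^+ 2]expr2 -expRD expRK; ring.
  by rewrite int_bs// lee_fin lnWs; nra.
apply: ge0_subset_integral_nonmeasurable.
  by move=> r; rewrite /= !in_itv/= => /andP[-> /le_trans]; exact.
move=> r; rewrite /= in_itv/= => rbe; rewrite lee_fin.
by rewrite addr_ge0 ?mulr_ge0 ?k0.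
Qed.

Theorem theorem3 (R : realType) (T kappa : R) (a : R -> R)
    (K K' : R -> R -> R) (u0 uobs0 : R -> R) (uobs u ut psi : R -> R -> R)
    (T_gt0 : 0 < T)
    (a_W1infty : W1infty a)
    (K_periodic : forall t, 0 <= t <= T -> periodic (K t) 1)
    (K_ge0 : forall t x, 0 <= t <= T -> 0 <= K t x)
    (kappa_gt0 : 0 < kappa)
    (K'E : forall t x, 0 <= t <= T -> K' t x = kappa * K t x)
    (uobs_sol : transport_solution T a (fun _ _ => 0) uobs)
    (uobs_init : forall x, uobs 0 x = uobs0 x)
    (u_sol : transport_solution T a
               (fun t x => - K t x * (u t x - uobs t x)) u)
    (u_init : forall x, u 0 x = u0 x)
    (ut_sol : transport_solution T a
                (fun t x => K' t x * (ut t x - uobs t x)) ut)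
    (ut_final : forall x, ut T x = u T x)
    (psi_char : characteristics T a psi)
    (psi_inj : non_intersecting T psi) :
  let w := fun t x => u t x - uobs t x in
  let wt := fun t x => ut t x - uobs t x in
  [/\ (* constant gain *)
      forall K0 : R,
        (forall t x, 0 <= t <= T -> K t x = K0) ->
        forall t x, 0 <= t <= T ->
          wt t x = w t x * expR ((- K0 - kappa * K0) * (T - t)),
      (* gain constant on a time window *)
      forall K0 t1 t2 : R,
        0 < K0 -> 0 <= t1 -> t1 < t2 -> t2 <= T ->
        (forall t x, 0 <= t <= T -> K t x = K0 * \1_(`[t1, t2]%classic) t) ->
        forall x,
          wt 0 x = w 0 x * expR ((- K0 - kappa * K0) * (t2 - t1))
    & (* time-independent gain; the integral may be +oo, with exp(-oo) = 0 *)
      forall Kx : R -> R,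
        (forall t x, 0 <= t <= T -> K t x = Kx x) ->
        forall t x, 0 <= t <= T ->
          ((wt t (psi t x))%:E =
           (w t (psi t x))%:E *
           expeR (- \int[@lebesgue_measure R]_(s in `[t, T])
                      (Kx (psi s x) + kappa * Kx (psi s x))%:E))%E].
Proof.
move=> w wt.
have [_ ca _ _] := a_W1infty.
have K'_sol g : (forall t x, 0 <= t <= T -> K t x = g t) ->
    transport_solution T a (fun t x => - g t * (u t x - uobs t x)) u /\
    transport_solution T a (fun t x => kappa * g t * (ut t x - uobs t x)) ut.
  move=> Kg; split.
    by apply: transport_solution_ext u_sol => t x tT; rewrite Kg.
  by apply: transport_solution_ext ut_sol => t x tT; rewrite K'E// Kg.
have T0T : 0 <= (0 : R) <= T by rewrite lexx ltW.
split.
- move=> K0 KK0 t x tT.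
  have [us uts] := K'_sol (fun=> K0) KK0.
  apply: (@nudging_time_dependent_gain R T kappa a (fun=> K0)
    (fun t => expR ((- K0 - kappa * K0) * (T - t))) [::] uobs u ut T_gt0 kappa_gt0
    _ uobs_sol us uts ut_final) => [|||s _ _|].
  + by move=> s sT; rewrite -(KK0 0 0)// K_ge0.
  + move=> s; apply: continuous_comp; last exact: continuous_expR.
    by apply: cvgM; [exact: cvg_cst|apply: cvgB; [exact: cvg_cst|exact: cvg_id]].
  + by rewrite subrr mulr0 expR0.
  + by apply: is_derive_eq; rewrite /GRing.scale/=; ring.
  + exact: tT.
- move=> K0 t1 t2 K0_gt0 t1_ge0 t12 t2T KK0 x.
  have [us uts] := K'_sol (fun t => K0 * \1_(`[t1, t2]%classic) t) KK0.
  pose theta t := expR (- (K0 + kappa * K0) * (t2 - Num.max t1 (Num.min t t2))).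
  have theta0 : theta 0 = expR ((- K0 - kappa * K0) * (t2 - t1)).
    rewrite /theta min_l ?max_l ?opprD//.
    by rewrite (le_trans t1_ge0)// ltW.
  rewrite -theta0.
  apply: (@nudging_time_dependent_gain R T kappa a
    (fun t => K0 * \1_(`[t1, t2]%classic) t)
    theta [:: t1; t2] uobs u ut T_gt0 kappa_gt0 _ uobs_sol us uts ut_final)
    => [|||s _ sE|].
  + by move=> s sT; apply: mulr_ge0; [exact: ltW|by rewrite indicE].
  + move=> s; apply: continuous_comp; last exact: continuous_expR.
    apply: cvgM; first exact: cvg_cst.
    apply: cvgB; first exact: cvg_cst.
    apply: (@continuous_max R R (cst t1) (fun r => Num.min r t2)).
      exact: cvg_cst.
    apply: (@continuous_min R R id (cst t2)); first exact: cvg_id.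
    exact: cvg_cst.
  + by rewrite /theta (min_r t2T) (max_r (ltW t12)) subrr mulr0 expR0.
  + have dth := is_derive_window_weight (K0 + kappa * K0) t12 sE.
    by apply: (is_derive_eq dth); rewrite /theta; ring.
  + exact: T0T.
- move=> Kx KKx t x /andP[t0 tT].
  have [cuo [Eo dUo]] := transport_solution_along x ca uobs_sol psi_char.
  have [cu [Eu dU]] := transport_solution_along x ca u_sol psi_char.
  have [cut [Et dUt]] := transport_solution_along x ca ut_sol psi_char.
  have sub (h : R -> R) : {within `[0, T], continuous h} ->
      {within `[t, T], continuous h}.
    apply: continuous_subspaceW => s; rewrite /= !in_itv/= => /andP[ts ->].
    by rewrite (le_trans t0).
  have inT s : t < s < T -> 0 < s < T.
    by move=> /andP[ts ->]; rewrite (le_lt_trans t0).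
  have dW s : t < s < T -> s \notin Eo ++ Eu ++ Et ->
      [/\ is_derive s 1 (fun r => w r (psi r x)) (- Kx (psi s x) * w s (psi s x)),
          is_derive s 1 (fun r => wt r (psi r x))
            (kappa * Kx (psi s x) * wt s (psi s x)) &
          {for s, continuous (fun r => - Kx (psi r x) * w r (psi r x))}].
    move=> /inT sT; rewrite !mem_cat !negb_or => /and3P[so su st].
    have [do_ _] := dUo s sT so; have [du cdu] := dU s sT su.
    have [dut _] := dUt s sT st.
    have sT' : 0 <= s <= T by case/andP: sT => *; rewrite !ltW.
    split.
    + by apply: is_derive_eq; rewrite KKx// subr0.
    + by apply: is_derive_eq; rewrite K'E// KKx// subr0.
    + move: cdu; rewrite /prop_for/continuous_at/= KKx// => cdu.
      apply: cvg_trans cdu; apply: near_eq_cvg; near=> r.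
      rewrite KKx//; apply/andP; split; near: r.
        by apply: lt_le_nbhsr; case/andP: sT.
      by apply: lt_le_nbhsl; case/andP: sT.
  apply: (@damped_amplified_ratio R t T kappa (Eo ++ Eu ++ Et)
    (fun s => Kx (psi s x)) (fun s => w s (psi s x)) (fun s => wt s (psi s x))).
  + by [].
  + exact: ltW.
  + by apply: sub => s; apply: cvgB; [exact: cu|exact: cuo].
  + by apply: sub => s; apply: cvgB; [exact: cut|exact: cuo].
  + move=> s /andP[ts sT]; have sT' : 0 <= s <= T by rewrite (le_trans t0).
    by rewrite -(KKx s)// K_ge0.
  + by move=> s tsT /(dW s tsT)[].
  + by move=> s tsT /(dW s tsT)[].
  + by move=> s tsT /(dW s tsT)[].
  + by rewrite /w /wt ut_final.
Unshelve. all: by end_near. Qed.
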